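(* Let $\Sigma$ be a finite CP set of real $n\times n$-matrices, let $R$ be a linearly ordered set, and let $A:R\to\Sigma$ be a map. Let $M(S)$, $S\subseteq R$, denote the product $\prod_{r\in S}A(r)$. Then the matrix $M(R)$ is the limit of the finite products $M(G)$ over the finite sets $G\subseteq R$ directed by inclusion; that is, for each $\varepsilon>0$ there exists a finite set $F\subseteq R$ such that $\|M(F')-M(R)\|<\varepsilon$ for all finite $F'$ with $F\subseteq F'\subseteq R$.
   Context: Let $\Sigma=\{A_j: j\in J\}$, $J=\{1,\dots,k\}$, be a finite set of real $n\times n$-matrices. $\Sigma$ is LCP if for every sequence $j_1,j_2,\dots$ in $J$ the products $A_{j_m}\cdots A_{j_1}$ converge as $m\to\infty$; it is RCP if for every such sequence the products $A_{j_1}\cdots A_{j_m}$ converge as $m\to\infty$. For $J'\subseteq J$ let $N_{J'}=\bigcap_{j\in J'}N(I-A_j)$ (intersection of nullspaces) and let $R_{J'}$ be the linear span of the ranges $R(I-A_j)$, $j\in J'$. $\Sigma$ is transversal if $N_{J'}\oplus R_{J'}=\mathbb{R}^n$ for each $J'\subseteq J$. $\Sigma$ is CP if it is LCP, RCP and transversal. For $J'\subseteq J$, $P_{J'}$ denotes the projection onto $N_{J'}$ along $R_{J'}$. Definition of $M(S)=\prod_{r\in S}A(r)$ for a subset $S$ of a linearly ordered set $R$ and a map $A:R\to\Sigma$. An interval of $S$ is a subset $T\subseteq S$ such that $a,b\in T$, $g\in S$, $a<g<b$ imply $g\in T$. Let $J_S=\{j\in J: A_j\in A(S)\}$. An interval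 $T$ of $S$ is complete if $A(T)=A(S)$, and incomplete otherwise. Let $I_S(A)$ be the maximal number of pairwise disjoint complete intervals of $S$ ($I_S(A)=\infty$ if this number is unbounded). The matrix $M(S)$ is defined by induction on the cardinality of $J_S$: $M(\emptyset)=I$. If $S\neq\emptyset$ and $I_S(A)=\infty$, then $M(S)=P_{J_S}$. If $S\ne\emptyset$, $I_S(A)<\infty$ and $J_S$ has at least two elements, then $S$ can be partitioned into finitely many disjoint adjacent incomplete intervals $S_1<\dots<S_m$ and $M(S)=M(S_1)\cdots M(S_m)$ (this does not depend on the partition). If $I_S(A)<\infty$ and $J_S=\{j\}$, then $S$ is finite and $M(S)=A_j^{\#S}$. In particular, for finite $S=\{s_1<\dots<s_m\}$ one has $M(S)=A(s_1)\cdots A(s_m)$. $\|\cdot\|$ is a matrix norm. *)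

(* Defs.v *)
From HB Require Import structures.
From mathcomp Require Import all_boot all_order all_algebra finmap.
From mathcomp Require Import all_classical all_reals all_analysis.

Set Implicit Arguments.
Unset Strict Implicit.
Unset Printing Implicit Defensive.

Import Order.TTheory GRing.Theory Num.Theory.
Import numFieldNormedType.Exports.

Local Open Scope classical_set_scope.
Local Open Scope ring_scope.

(* A finite set of matrices is a term [Sg : {fset 'M[R]_n}], and the index set J
   is [Sg] itself, seen as a finite type: J' is a [{set Sg}], and a sequence
   j_1, j_2, ... in J is a function [nat -> Sg] (shifted to start at 0). *)

Section CPsets.
Context {R : realType} {n : nat} (Sg : {fset 'M[R]_n}).
Implicit Types (J : {set Sg}) (s : nat -> Sg).

Definition LCP : Prop :=
  forall s, cvgn (fun m => \prod_(i < m) val (s (rev_ord i)) : 'M[R]_n).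

Definition RCP : Prop :=
  forall s, cvgn (fun m => \prod_(i < m) val (s i) : 'M[R]_n).

(* I - X acting on column vectors *)
Definition id_sub (X : 'M[R]_n) : 'End('cV[R]_n) := linfun (mulmx (1%:M - X)).

Definition nullJ J : {vspace 'cV[R]_n} :=
  (\bigcap_(X in J) lker (id_sub (val X)))%VS.

Definition rangeJ J : {vspace 'cV[R]_n} :=
  (\sum_(X in J) limg (id_sub (val X)))%VS.

Definition transversal : Prop :=
  forall J, (nullJ J :&: rangeJ J = 0)%VS /\ (nullJ J + rangeJ J = fullv)%VS.

Definition CP : Prop := [/\ LCP, RCP & transversal].

(* The matrix, acting on column vectors, of the projection onto [nullJ J] along
   [rangeJ J]: its j-th column is the image of the j-th unit vector. *)
Definition projJ J : 'M[R]_n :=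
  \matrix_(i, j) (daddv_pi (nullJ J) (rangeJ J) (delta_mx j 0 : 'cV[R]_n)) i 0.

End CPsets.

Section OrderedProduct.
Context {R : realType} {n : nat} (Sg : {fset 'M[R]_n}).
Context {d : Order.disp_t} {T : orderType d} (A : T -> Sg).
Implicit Types S U : set T.

Definition interval_of S U : Prop :=
  U `<=` S /\
  forall a b g, U a -> U b -> S g -> (a < g)%O -> (g < b)%O -> U g.

Definition complete_interval S U : Prop :=
  interval_of S U /\ A @` U = A @` S.

Definition incomplete_interval S U : Prop :=
  interval_of S U /\ A @` U <> A @` S.

Definition JS S : {set Sg} := finset (fun X : Sg => `[< (A @` S) X >]).

Definition disjoint_complete S (m : nat) : Prop :=
  exists U : 'I_m -> set T,
    (forall i, complete_interval S (U i)) /\ trivIset setT U.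

(* I_S(A) = oo *)
Definition infinite_IS S : Prop := forall m, disjoint_complete S m.

(* S is the disjoint union of the nonempty incomplete intervals
   U_0 < ... < U_(m-1). *)
Definition incomplete_partition S (m : nat) (U : 'I_m -> set T) : Prop :=
  [/\ forall i, U i !=set0 /\ incomplete_interval S (U i),
      \bigcup_i U i = S
    & forall (i j : 'I_m) x y, (i < j)%N -> U i x -> U j y -> (x < y)%O].

(* [is_product S M]: M is a value of M(S), obtained with some choice of the
   partitions used along the induction on the cardinality of [JS S]. *)
Inductive is_product : set T -> 'M[R]_n -> Prop :=
| is_product_empty : is_product set0 1%:M
| is_product_infinite S :
    S !=set0 -> infinite_IS S -> is_product S (projJ (JS S))
| is_product_split S (m : nat) (U : 'I_m -> set T) (M : 'I_m -> 'M[R]_n) :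
    S !=set0 -> ~ infinite_IS S -> (2 <= #|JS S|)%N ->
    incomplete_partition S U ->
    (forall i, is_product (U i) (M i)) ->
    is_product S (\prod_(i < m) M i)
| is_product_power S (X : Sg) (m : nat) :
    S !=set0 -> ~ infinite_IS S -> JS S = [set X]%SET ->
    (S #= `I_m)%card -> is_product S (val X ^+ m).

(* M(S); the default 0 is only used if [is_product S] has no solution. *)
Definition Mprod S : 'M[R]_n := xget 0 (is_product S).

End OrderedProduct.

(* A norm on the real vector space of matrices; submultiplicativity is not
   required. *)
Definition matrix_norm {R : realType} {n : nat} (N : 'M[R]_n -> R) : Prop :=
  [/\ forall X, 0 <= N X,
      forall X, N X = 0 -> X = 0,
      forall (c : R) X, N (c *: X) = `|c| * N X
    & forall X Y, N (X + Y) <= N X + N Y].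

(* Main.v *)
Require Import Defs.
From mathcomp Require Import all_boot all_order all_algebra finmap.
From mathcomp Require Import all_classical all_reals all_analysis.
From mathcomp Require Import zify ring lra.

(** Call a word complete over a set J of letters if its letters are exactly
those of J, and let P be the projection onto N_J along R_J.

The value M(S) is the limit of the finite products over S by induction on the
construction of M(S) ([is_product_net_limit]).  If S is empty or carries a
single letter finitely often, the net of finite products is eventually
constant.  If S is cut into intervals S_1 < ... < S_m, a finite product over S
is the product of its parts in the S_i, and multiplication is continuous
([net_limit_prod]).  The analytic case is I_S = oo, J = J_S.  A finite set F
that meets m disjoint complete intervals in witnesses of all the letters forces
every finite product over a larger set to contain m consecutive complete
blocks, so it remains to see that words over J with many complete blocks are
uniformly close to P ([word_prod_near_projJ]).

For that, write a word product W over J as P + W (1 - P), the letters being the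
identity on N_J.  Under RCP all word products are bounded
([RCP_product_bounded]).  Suppose W (1 - P) is not uniformly small.  Complete
blocks may be arbitrarily long, so there are infinitely many of them; but their
products lie in a bounded set, so up to a small error only finitely many occur,
and one of them can be used as a first block that keeps the rest of the word
bad, with an arbitrarily small loss ([far_extend]).  Iterating with summable
losses gives one infinite word in which every letter of J recurs.  Its limit L
satisfies L A_j = L for all j in J, hence vanishes on R_J, so that
L W (1 - P) = L (1 - P) = 0 for all words W over J, contradicting badness
([not_far1]).

A value M(S) exists because a set that cannot be cut into finitely many
incomplete intervals falls into a complete interval and another such set
([not_splittable_peel]), which can be repeated any number of times and so gives
I_S = oo.  For a finite set the net is constant from the set itself on, so its
value is the product of its letters in increasing order. *)

Set Implicit Arguments.
Unset Strict Implicit.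
Unset Printing Implicit Defensive.

Import Order.TTheory GRing.Theory Num.Theory.
Import numFieldNormedType.Exports.

Local Open Scope classical_set_scope.
Local Open Scope ring_scope.

(** * A submultiplicative norm *)

Section EntryNorm.
Context {R : realType}.

(** The l1 norm of the entries: it is submultiplicative for matrices of all
sizes, including empty ones. *)
Definition entry_norm p q (X : 'M[R]_(p, q)) : R := \sum_i \sum_j `|X i j|.

Lemma entry_norm_ge0 p q (X : 'M[R]_(p, q)) : 0 <= entry_norm X.
Proof. by apply: sumr_ge0 => i _; apply: sumr_ge0. Qed.

Lemma entry_norm0 p q : entry_norm (0 : 'M[R]_(p, q)) = 0.
Proof.
by apply: big1 => i _; apply: big1 => j _; rewrite mxE normr0.
Qed.

Lemma entry_normD p q (X Y : 'M[R]_(p, q)) :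
  entry_norm (X + Y) <= entry_norm X + entry_norm Y.
Proof.
rewrite -big_split; apply: ler_sum => i _; rewrite -big_split.
by apply: ler_sum => j _; rewrite mxE ler_normD.
Qed.

Lemma entry_normN p q (X : 'M[R]_(p, q)) : entry_norm (- X) = entry_norm X.
Proof.
by apply: eq_bigr => i _; apply: eq_bigr => j _; rewrite mxE normrN.
Qed.

Lemma entry_norm_le_add p q (X Y : 'M[R]_(p, q)) :
  entry_norm X <= entry_norm Y + entry_norm (X - Y).
Proof. by rewrite -{1}[X](subrK Y) [X - Y + Y]addrC entry_normD. Qed.

Lemma le_entry_norm p q (X : 'M[R]_(p, q)) i j : `|X i j| <= entry_norm X.
Proof.
rewrite /entry_norm (bigD1 i) //= (bigD1 j) //= -addrA lerDl addr_ge0 //.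
  exact: sumr_ge0.
by apply: sumr_ge0 => k _; apply: sumr_ge0.
Qed.

Lemma entry_normM p q r (X : 'M[R]_(p, q)) (Y : 'M[R]_(q, r)) :
  entry_norm (X *m Y) <= entry_norm X * entry_norm Y.
Proof.
rewrite /entry_norm mulr_suml; apply: ler_sum => i _.
rewrite mulr_suml.
apply: (@le_trans _ _ (\sum_k \sum_j `|X i j| * `|Y j k|)).
  apply: ler_sum => k _; rewrite mxE.
  by apply: le_trans (ler_norm_sum _ _ _) _; under eq_bigr do rewrite normrM.
rewrite exchange_big; apply: ler_sum => j _; rewrite -mulr_sumr ler_wpM2l //.
rewrite (bigD1 j) //= lerDl.
by apply: sumr_ge0 => k _; apply: sumr_ge0.
Qed.

Lemma entry_norm_eq0 p q (X : 'M[R]_(p, q)) :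
  (forall e, 0 < e -> entry_norm X < e) -> X = 0.
Proof.
move=> h; apply/matrixP => i j; rewrite mxE; apply/normr0_eq0.
apply/le_anti; rewrite normr_ge0 andbT; apply/ler_addgt0Pl => e e0.
by rewrite addr0 (le_trans (le_entry_norm _ _ _)) // ltW // h.
Qed.

Lemma entry_norm_lt n (X : 'M[R]_n) e : 0 < e ->
  (forall i j, `|X i j| <= e / (n * n + 1)%:R) -> entry_norm X < e.
Proof.
set c := e / _ => e0 Xc; have c0 : 0 < c by rewrite divr_gt0 // ltr0n addn1.
apply: (@le_lt_trans _ _ (\sum_(i < n) \sum_(j < n) c)).
  by apply: ler_sum => i _; apply: ler_sum => j _.
rewrite !sumr_const !card_ord -mulrnA -[_ *+ (n * n)]mulr_natl mulrCA gtr_pMr //.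
by rewrite ltr_pdivrMr ?ltr0n ?addn1 // mul1r ltr_nat.
Qed.

Lemma matrix_norm_le_entry_norm n (N : 'M[R]_n -> R) : matrix_norm N ->
  exists2 c, 0 < c & forall X, N X <= c * entry_norm X.
Proof.
case=> N0 _ NZ ND.
exists (1 + \sum_i \sum_j N (delta_mx i j)).
  by rewrite ltr_wpDr // sumr_ge0 // => i _; rewrite sumr_ge0.
move=> X; have N00 : N 0 = 0 by rewrite -(scale0r 0) NZ normr0 mul0r.
have Nsum (I : finType) (F : I -> 'M[R]_n) : N (\sum_i F i) <= \sum_i N (F i).
  elim/big_rec2: _ => [|i y X' _ h]; first by rewrite N00.
  by rewrite (le_trans (ND _ _)) // lerD2l.
rewrite {1}[X]matrix_sum_delta (le_trans (Nsum _ _)) //.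
rewrite /entry_norm mulr_sumr; apply: ler_sum => i _.
apply: le_trans (Nsum _ _) _; rewrite mulr_sumr; apply: ler_sum => j _.
rewrite NZ mulrC ler_wpM2r //.
rewrite (bigD1 i) //= (bigD1 j) //= addrCA -!addrA lerDl !addr_ge0 //.
  by rewrite sumr_ge0.
by rewrite sumr_ge0 // => k _; rewrite sumr_ge0.
Qed.

Lemma cvg_entry_norm n (u : nat -> 'M[R]_n) : cvgn u ->
  exists L, forall e, 0 < e ->
    exists m0, forall m, (m0 <= m)%N -> entry_norm (u m - L) < e.
Proof.
move=> /cvg_ex[L uL]; exists L => e e0.
pose c : R := e / (n * n + 1)%:R.
have c0 : 0 < c by rewrite divr_gt0 // ltr0n addn1.
have /cvg_ballP/(_ _ c0)[m0 _ hm0] := uL.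
exists m0 => m /hm0 [_ hm]; apply: entry_norm_lt => // i j.
by rewrite !mxE distrC ltW //; exact: hm.
Qed.

(** Total boundedness in pigeonhole form: cut the cube containing all the [f w]
into finitely many small cells. *)
Lemma bounded_finite_cells n (W : Type) (f : W -> 'M[R]_n) (C e : R) :
  (forall w, entry_norm (f w) <= C) -> 0 < e ->
  exists (I : finType) (h : W -> I),
    forall w w', h w = h w' -> entry_norm (f w - f w') < e.
Proof.
move=> fC e0.
pose c : R := e / (n * n + 1)%:R.
have c0 : 0 < c by rewrite divr_gt0 // ltr0n addn1.
pose K := Num.truncn ((C + C) / c).
pose g w i j := Num.truncn ((f w i j + C) / c).
have fb w i j : 0 <= f w i j + C <= C + C.
  have := le_trans (le_entry_norm (f w) i j) (fC w).
  by rewrite ler_norml lerD2r => /andP[h ->]; rewrite -lerBlDr sub0r h.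
have gK w i j : (g w i j < K.+1)%N.
  have /andP[h1 h2] := fb w i j.
  by rewrite ltnS le_truncn // ler_pM2r ?invr_gt0.
exists {ffun 'I_n * 'I_n -> 'I_K.+1}.
exists (fun w => [ffun ij => Ordinal (gK w ij.1 ij.2)]) => w w' hw.
apply: entry_norm_lt => // i j; rewrite !mxE -/c.
have gg : g w i j = g w' i j.
  by have /ffunP/(_ (i, j)) := hw; rewrite !ffunE => /(congr1 val).
have bd v : (g v i j)%:R * c <= f v i j + C < (g v i j)%:R * c + c.
  have /andP[h1 _] := fb v i j.
  have -> : (g v i j)%:R * c + c = (g v i j).+1%:R * c.
    by rewrite -natr1 mulrDl mul1r.
  rewrite -ler_pdivlMr // -ltr_pdivrMr //.
  by apply: truncn_itv; rewrite divr_ge0 // ltW.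
have /andP[a1 a2] := bd w; have /andP[b1 b2] := bd w'.
by rewrite ler_norml; rewrite gg in a1 a2; apply/andP; split; lra.
Qed.

End EntryNorm.

(** * Word products under RCP *)

Section Words.
Context {R : realType} {n : nat} (Sg : {fset 'M[R]_n}).
Implicit Types (u v w : seq Sg) (J : {set Sg}) (X Y : 'M[R]_n).

Definition word_prod w : 'M[R]_n := \prod_(x <- w) val x.

Lemma word_prod_nil : word_prod [::] = 1%:M.
Proof. exact: big_nil. Qed.

Lemma word_prod_cat u v : word_prod (u ++ v) = word_prod u *m word_prod v.
Proof. exact: big_cat. Qed.

Lemma word_prod1 x : word_prod [:: x] = val x.
Proof. exact: big_seq1. Qed.

Lemma size_increasing_words (u : nat -> seq Sg) k :
  (forall k, exists2 v, v != [::] & u k.+1 = u k ++ v) -> (k <= size (u k))%N.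
Proof.
move=> hu; elim: k => // k IH; have [v v0 ->] := hu k.
by rewrite size_cat -addn1 leq_add // lt0n size_eq0.
Qed.

(** The words [u k] are initial segments of one infinite word, to which RCP
applies.  All initial segments are covered, not only the [u k], so that letters
inside the increments can be looked at. *)
Lemma increasing_words_cvg (u : nat -> seq Sg) : RCP Sg ->
  (forall k, exists2 v, v != [::] & u k.+1 = u k ++ v) ->
  exists L : 'M[R]_n, forall e, 0 < e -> exists m0, forall k p q,
    u k = p ++ q -> (m0 <= size p)%N -> entry_norm (word_prod p - L) < e.
Proof.
move=> rcp hu.
have us k := size_increasing_words k hu.
have x0 : Sg by case: (u 1%N) (us 1%N) => // x.
have uS k l : (k <= l)%N -> exists v, u l = u k ++ v.
  move=> /subnK <-; elim: (l - k)%N => [|i [v IH]].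
    by exists [::]; rewrite cats0.
  by have [v' _ e] := hu (i + k)%N; exists (v ++ v'); rewrite addSn e IH catA.
pose s i := nth x0 (u i.+1) i.
have sP k i : (i < size (u k))%N -> s i = nth x0 (u k) i.
  move=> ik; rewrite /s; case: (leqP k i.+1) => h.
    by have [v ->] := uS _ _ h; rewrite nth_cat ik.
  by have [v ->] := uS _ _ (ltnW h); rewrite nth_cat us.
have [L hL] := cvg_entry_norm (rcp s).
exists L => e /hL[m0 hm0]; exists m0 => k p q upq /hm0.
suff -> : \prod_(i < size p) val (s i) = word_prod p by [].
rewrite /word_prod (big_nth x0) big_mkord; apply: eq_bigr => i _.
by rewrite (sP k) upq ?nth_cat ?ltn_ord // size_cat ltn_addr.
Qed.

Definition orbit_bounded X : Prop :=
  exists C, forall w, entry_norm (X *m word_prod w) <= C.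

Lemma orbit_boundedMl X Y : orbit_bounded Y -> orbit_bounded (X *m Y).
Proof.
case=> C hC; exists (entry_norm X * C) => w; rewrite -mulmxA.
by rewrite (le_trans (entry_normM _ _)) // ler_wpM2l // entry_norm_ge0.
Qed.

Lemma orbit_boundedD X Y :
  orbit_bounded X -> orbit_bounded Y -> orbit_bounded (X + Y).
Proof.
case=> C hC [D hD]; exists (C + D) => w; rewrite mulmxDl.
by rewrite (le_trans (entry_normD _ _)) // lerD.
Qed.

(** The matrices with bounded orbit are those whose rows lie in one subspace,
the row space of a matrix [E] of maximal rank among them.  Hence a single bound,
the one for [E], controls the orbits of all of them ([X = (X E^+) E]). *)
Lemma orbit_bounded_generator :
  exists2 E, orbit_bounded E & forall X, orbit_bounded X -> (X <= E)%MS.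
Proof.
pose P r := `[< exists2 E : 'M[R]_n, orbit_bounded E & \rank E = r >].
have exP : exists r, P r.
  exists 0%N; apply/asboolP; exists 0; last exact: mxrank0.
  by exists 0 => w; rewrite mul0mx entry_norm0.
have ubP r : P r -> (r <= n)%N by move/asboolP => [E _ <-]; exact: rank_leq_col.
case: (ex_maxnP exP ubP) => r /asboolP[E bE rE] maxr.
exists E => // X bX.
have /sub_addsmxP[u hu] := submx_refl (E + X)%MS.
have bEX : orbit_bounded (E + X)%MS.
  by rewrite hu; apply: orbit_boundedD; exact: orbit_boundedMl.
have /maxr rEX : P (\rank (E + X)%MS) by apply/asboolP; exists (E + X)%MS.
apply: submx_trans (addsmxSr E X) _.
have /leqifP := mxrank_leqif_sup (addsmxSl E X); case: ifP => // _.
by rewrite ltnNge rE rEX.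
Qed.

(** If the orbit of 1 were unbounded, one could extend words step by step, each
time increasing the norm by 1 and keeping the orbit unbounded, and the resulting
infinite word would have no limit.  Such an extension exists: otherwise the
words whose orbit is still unbounded have bounded products, and once a word
leaves this class its extensions are controlled by [orbit_bounded_generator]. *)
Lemma RCP_product_bounded : RCP Sg ->
  exists2 C, 0 < C & forall w, entry_norm (word_prod w) <= C.
Proof.
move=> rcp.
suff [C hC] : orbit_bounded 1%:M.
  exists (1 + C) => [|w].
    by rewrite ltr_wpDr // (le_trans (entry_norm_ge0 _) (hC [::])).
  by rewrite (le_trans _ (ler_wpDl _ (hC w))) // mul1mx.
apply: contrapT => nb1.
have [E [CE hE] Emax] := orbit_bounded_generator.
have step u : exists v, ~ orbit_bounded (word_prod u) ->
    ~ orbit_bounded (word_prod (u ++ v)) /\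
    entry_norm (word_prod u) + 1 <= entry_norm (word_prod (u ++ v)).
  apply: contrapT => /forallNP no; have nbu : ~ orbit_bounded (word_prod u).
    by move=> b; apply: (no [::]) => /(_ b).
  apply: (nbu); set K := entry_norm (word_prod u) + 1.
  have K0 : 0 <= K by rewrite addr_ge0 // entry_norm_ge0.
  have hK v : ~ orbit_bounded (word_prod (u ++ v)) ->
      entry_norm (word_prod (u ++ v)) <= K.
    move=> nb; rewrite leNgt; apply/negP => lt; apply: (no v) => _.
    by split=> //; exact: ltW.
  pose a := \sum_(x : Sg) entry_norm (val x).
  have ha (x : Sg) : entry_norm (val x) <= a.
    rewrite /a (bigD1 x) //= lerDl; apply: sumr_ge0 => y _.
    exact: entry_norm_ge0.
  have a0 : 0 <= a by apply: sumr_ge0 => y _; exact: entry_norm_ge0.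
  (* [w1] is the first initial segment of [w] after which the orbit is bounded:
     one letter, of norm at most [a], beyond a product of norm at most [K]. *)
  have exit w : orbit_bounded (word_prod (u ++ w)) -> exists w1 w2,
      [/\ w = w1 ++ w2, orbit_bounded (word_prod (u ++ w1)) &
          entry_norm (word_prod (u ++ w1)) <= K * a].
    elim/last_ind: w => [|w x IH] b; first by rewrite cats0 in b.
    case: (pselect (orbit_bounded (word_prod (u ++ w)))) => [|nb].
      move=> /IH[w1 [w2 [-> b1 n1]]]; exists w1, (rcons w2 x).
      by rewrite rcons_cat.
    exists (rcons w x), [::]; rewrite cats0; split=> //.
    rewrite -cats1 catA word_prod_cat word_prod1.
    apply: le_trans (entry_normM _ _) _.
    by rewrite ler_pM ?entry_norm_ge0 ?hK.
  exists (K + K * a * entry_norm (pinvmx E) * CE) => w.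
  have CE0 : 0 <= CE := le_trans (entry_norm_ge0 _) (hE [::]).
  rewrite -word_prod_cat.
  case: (pselect (orbit_bounded (word_prod (u ++ w)))) => [|nb]; last first.
    by rewrite (le_trans (hK _ nb)) // lerDl !mulr_ge0 // entry_norm_ge0.
  move=> /exit[w1 [w2 [-> b1 n1]]].
  rewrite catA word_prod_cat -(mulmxKpV (Emax _ b1)) -(mulmxA _ E).
  apply: le_trans (entry_normM _ _) _.
  apply: ler_wpDl => //; apply: ler_pM => //; rewrite ?entry_norm_ge0 //.
  apply: le_trans (entry_normM _ _) _.
  by rewrite ler_wpM2r // entry_norm_ge0.
have [g gP] := choice step.
pose u k := iter k (fun w => w ++ g w) [::].
have nbu k : ~ orbit_bounded (word_prod (u k)).
  by elim: k => [|k /gP[]//]; rewrite /u /= word_prod_nil.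
have gP' k := gP _ (nbu k).
have nu k : k%:R <= entry_norm (word_prod (u k)).
  elim: k => [|k IH]; first exact: entry_norm_ge0.
  by have [_] := gP' k; apply: le_trans; rewrite -natr1 lerD2r.
have ug k : exists2 v, v != [::] & u k.+1 = u k ++ v.
  exists (g (u k)) => //; apply/negP => /eqP g0.
  by have [_] := gP' k; rewrite g0 cats0 gerDl ler10.
have us k := size_increasing_words k ug.
have [L hL] := increasing_words_cvg rcp ug.
have [m0 hm0] := hL 1 ltr01.
pose k := maxn m0 (Num.truncn (entry_norm L + 1)).+1.
have := hm0 k (u k) [::]; rewrite cats0 => /(_ erefl).
rewrite (leq_trans (leq_maxl _ _) (us k)) => /(_ isT) lt1.
have : entry_norm L + 1 < k%:R.
  by rewrite (lt_le_trans (truncnS_gt _)) // ler_nat leq_maxr.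
have := entry_norm_le_add (word_prod (u k)) L; have := nu k; lra.
Qed.

End Words.

(** * Words with many complete blocks *)

Section Projection.
Context {R : realType} {n : nat} (Sg : {fset 'M[R]_n}).
Implicit Types (w : seq Sg) (J : {set Sg}).

Lemma col_matrix_inj p q (X Y : 'M[R]_(p, q)) :
  (forall j, col j X = col j Y) -> X = Y.
Proof.
move=> XY; apply/matrixP => i j.
by have /matrixP/(_ i 0) := XY j; rewrite !mxE.
Qed.

Lemma mul_projJ J (x : Sg) : x \in J -> val x *m projJ J = projJ J.
Proof.
move=> xJ; apply: col_matrix_inj => j.
set v : 'cV[R]_n := daddv_pi (nullJ J) (rangeJ J) (delta_mx j 0).
have cP : col j (projJ J) = v.
  by apply/matrixP => i k; rewrite !mxE (ord1 k).
have : v \in lker (id_sub (val x)).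
  have /subvP : (nullJ J <= lker (id_sub (val x)))%VS.
    by apply: bigcapv_inf xJ _.
  by apply; exact: memv_pi.
rewrite memv_ker lfunE /= mulmxBl mul1mx subr_eq0 => /eqP fixv.
by rewrite [LHS]colE -mulmxA -colE cP -fixv.
Qed.

(** [L] kills every [R(I - A_j)], hence the complement [rangeJ J] of the range
of the projection. *)
Lemma mul_projJ_id J (L : 'M[R]_n) : Defs.transversal Sg ->
  (forall x : Sg, x \in J -> L *m val x = L) -> L *m projJ J = L.
Proof.
move=> /(_ J)[cap0 sumT] LJ; apply: col_matrix_inj => j.
set e : 'cV[R]_n := delta_mx j 0.
have cP : col j (projJ J) = daddv_pi (nullJ J) (rangeJ J) e.
  by apply/matrixP => i k; rewrite !mxE (ord1 k).
have ee : daddv_pi (nullJ J) (rangeJ J) e + daddv_pi (rangeJ J) (nullJ J) e = e.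
  by apply: daddv_pi_add; rewrite ?sumT ?memvf.
have : daddv_pi (rangeJ J) (nullJ J) e \in lker (linfun (mulmx L)).
  have /subvP : (rangeJ J <= lker (linfun (@mulmx R n n 1 L)))%VS.
    apply/subv_sumP => x xJ; apply/subvP => _ /memv_imgP[y _ ->].
    by rewrite memv_ker !lfunE /= mulmxA mulmxBr mulmx1 LJ // subrr mul0mx.
  by apply; exact: memv_pi.
rewrite memv_ker lfunE /= => /eqP L0.
rewrite [LHS]colE -mulmxA -colE cP [RHS]colE -/e -[in RHS]ee.
by rewrite mulmxDr L0 addr0.
Qed.

Lemma word_prod_projJ J w : {subset w <= J} ->
  word_prod w *m projJ J = projJ J.
Proof.
elim: w => [|x w IH] wJ; first by rewrite word_prod_nil mul1mx.
rewrite -cat1s word_prod_cat word_prod1 -mulmxA IH ?mul_projJ ?wJ ?mem_head //.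
by move=> y yw; rewrite wJ // inE yw orbT.
Qed.

Lemma mul_word_prod_id J (L : 'M[R]_n) w :
  (forall x : Sg, x \in J -> L *m val x = L) -> {subset w <= J} ->
  L *m word_prod w = L.
Proof.
move=> LJ; elim: w => [|x w IH] wJ; first by rewrite word_prod_nil mulmx1.
rewrite -cat1s word_prod_cat word_prod1 mulmxA LJ ?IH ?wJ ?mem_head //.
by move=> y yw; rewrite wJ // inE yw orbT.
Qed.

(** The part of the word after the [m] complete blocks may be any word over [J],
which makes the predicate monotone in [m]. *)
Fixpoint has_blocks J m w : Prop :=
  if m is m'.+1 then
    exists b w', [/\ w = b ++ w', b =i J & has_blocks J m' w']
  else {subset w <= J}.

Lemma has_blocks_sub J m w : has_blocks J m w -> {subset w <= J}.
Proof.
elim: m w => //= m IH w [b [w' [-> bJ /IH w'J]]] x.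
by rewrite mem_cat => /orP[|/w'J//]; rewrite bJ.
Qed.

Lemma has_blocks_le J m m' w : (m <= m')%N ->
  has_blocks J m' w -> has_blocks J m w.
Proof.
elim: m m' w => [|m IH] m' w; first by move=> _ /has_blocks_sub.
case: m' => //= m' mm' [b [w' [-> bJ h]]]; exists b, w'; split=> //.
exact: IH h.
Qed.

(** After a word with product [X], continuations with many complete blocks do
not become uniformly close to the projection: some stay at distance [e]. *)
Definition far J (e : R) (X : 'M[R]_n) : Prop :=
  forall m, exists2 w, has_blocks J m w &
    e < entry_norm (X *m word_prod w *m (1%:M - projJ J)).

(** If every complete block [b] brought the words [u ++ b] under the bound [e']
after some number [mb b] of further blocks, finitely many blocks, one for each
small cell of products, would give a common number of blocks, and the words
after [u] would come under the bound [e]. *)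
Lemma far_extend J e e' u : RCP Sg -> e' < e -> far J e (word_prod u) ->
  exists2 b, b =i J & far J e' (word_prod (u ++ b)).
Proof.
move=> rcp ee' far_u; apply: contrapT => no.
have nofar b : exists m, b =i J -> forall w, has_blocks J m w ->
    entry_norm (word_prod (u ++ b) *m word_prod w *m (1%:M - projJ J)) <= e'.
  apply: contrapT => /forallNP h; apply: no.
  exists b => [|m]; first by apply: contrapT => nb; apply: (h 0%N) => /nb.
  apply: contrapT => far_ub; apply: (h m) => _ w bw.
  by rewrite leNgt; apply/negP => lt; apply: far_ub; exists w.
have [mb mbP] := choice nofar.
have [C C0 hC] := RCP_product_bounded rcp.
pose Q : 'M[R]_n := 1%:M - projJ J.
(* Replacing the first block by one in the same cell costs at most
   [d * (C * entry_norm Q)]. *)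
pose d := (e - e') / (C * entry_norm Q + 1).
have D0 : 0 < C * entry_norm Q + 1.
  by rewrite ltr_wpDl // mulr_ge0 ?entry_norm_ge0 // ltW.
have d0 : 0 < d by rewrite divr_gt0 // subr_gt0.
have [I [h hP]] :=
  bounded_finite_cells (f := fun b => word_prod (u ++ b)) (fun b => hC _) d0.
have cells i : exists m, forall b, b =i J -> h b = i ->
    exists2 b', h b' = i & b' =i J /\ mb b' = m.
  case: (pselect (exists2 b, b =i J & h b = i)) => [[b bJ hb]|nob].
    by exists (mb b) => _ _ _; exists b.
  by exists 0%N => b bJ hb; case: nob; exists b.
have [mc mcP] := choice cells.
have [_ [b [w [-> bJ bw]]]] := far_u (\max_i mc i).+1.
have [b' hb' [b'J mb']] := mcP _ b bJ erefl.
have near : entry_norm (word_prod (u ++ b') *m word_prod w *m Q) <= e'.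
  by apply: (mbP _ b'J); apply: has_blocks_le bw; rewrite mb' leq_bigmax.
apply/negP; rewrite -leNgt -/Q word_prod_cat [_ *m (_ *m _)]mulmxA.
rewrite -word_prod_cat.
apply: le_trans (entry_norm_le_add _
  (word_prod (u ++ b') *m word_prod w *m Q)) _.
rewrite -lerBrDl; apply: (@le_trans _ _ (e - e')); last by rewrite lerD2l lerN2.
rewrite -!mulmxBl -mulmxA.
apply: le_trans (entry_normM _ _) _.
have := hP _ _ (esym hb'); rewrite ltr_pdivlMr // => /ltW; apply: le_trans.
rewrite ler_wpM2l ?entry_norm_ge0 // (le_trans (entry_normM _ _)) //.
by rewrite ler_wpDr // ler_wpM2r ?entry_norm_ge0.
Qed.

(** Iterating [far_extend] gives an infinite word made of complete blocks.  Its
limit [L] is fixed by right multiplication with the letters of [J], hence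
[L *m word_prod w *m (1 - P) = 0] for words [w] over [J]; but [L] is a limit of
products that are all far from this. *)
Lemma not_far1 J e : RCP Sg -> Defs.transversal Sg -> J != finset.set0 -> 0 < e ->
  ~ far J e 1%:M.
Proof.
move=> rcp tr J0 e0 far1.
(* Decreasing from [e], and bounded below by [e / 2]. *)
pose ek k := e / 2 + e / 2 ^+ k.+1.
have ekS k : ek k.+1 < ek k.
  rewrite /ek ltrD2l ltr_pM2l // ltf_pV2 ?posrE ?exprn_gt0 //.
  by rewrite ltr_pMl ?exprn_gt0 // ltr1n.
have step (p : nat * seq Sg) : exists b,
    far J (ek p.1) (word_prod p.2) ->
    b =i J /\ far J (ek p.1.+1) (word_prod (p.2 ++ b)).
  case: (pselect (far J (ek p.1) (word_prod p.2))) => [f|]; last by exists [::].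
  by have [b bJ fb] := far_extend rcp (ekS _) f; exists b.
have [g gP] := choice step.
pose u := fix u k := if k is k'.+1 then u k' ++ g (k', u k') else [::].
have ufar k : far J (ek k) (word_prod (u k)).
  elim: k => [|k IH]; last by have [] := gP (k, u k) IH.
  by rewrite /= word_prod_nil /ek expr1 -splitr.
have gJ k : g (k, u k) =i J by have [] := gP (k, u k) (ufar k).
have [x0 x0J] := set0Pn _ J0.
have uS k : exists2 v, v != [::] & u k.+1 = u k ++ v.
  exists (g (k, u k)) => //; apply/negP => /eqP gk.
  by have := gJ k x0; rewrite gk x0J.
have us k := size_increasing_words k uS.
have [L hL] := increasing_words_cvg rcp uS.
have LJ (x : Sg) : x \in J -> L *m val x = L.
  move=> xJ; apply/eqP; rewrite -subr_eq0; apply/eqP.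
  apply: entry_norm_eq0 => d d0.
  pose a := entry_norm (val x) + 1.
  have a0 : 0 < a by rewrite ltr_wpDl // entry_norm_ge0.
  have [m0 hm0] := hL (d / (2 * a)) ltac:(by rewrite divr_gt0 // mulr_gt0).
  (* [x] occurs in the block added to [u m0]: compare the products just before
     and just after this occurrence. *)
  have [v1 [v2 gv]] : exists v1 v2, g (m0, u m0) = v1 ++ x :: v2.
    have : x \in g (m0, u m0) by rewrite gJ.
    by case/path.splitPr => v1 v2; exists v1, v2.
  have u1 : u m0.+1 = (u m0 ++ v1) ++ x :: v2 by rewrite /= gv catA.
  have u2 : u m0.+1 = (u m0 ++ rcons v1 x) ++ v2 by rewrite u1 -!catA cat_rcons.
  have h1 := hm0 _ _ _ u1 _; have h2 := hm0 _ _ _ u2 _.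
  move: (h1 ltac:(by rewrite size_cat (leq_trans (us m0)) ?leq_addr)).
  move: (h2 ltac:(by rewrite size_cat (leq_trans (us m0)) ?leq_addr)).
  rewrite -cats1 catA word_prod_cat word_prod1.
  set W := word_prod _ => {}h2 {}h1.
  have -> : L *m val x - L = (W *m val x - L) - (W - L) *m val x.
    by rewrite mulmxBl opprB [RHS]addrC [RHS]addrA subrK.
  apply: le_lt_trans (entry_normD _ _) _; rewrite entry_normN.
  have n2 := entry_normM (W - L) (val x).
  have : entry_norm (W - L) * entry_norm (val x) <=
      d / (2 * a) * entry_norm (val x).
    by rewrite ler_wpM2r ?entry_norm_ge0 // ltW.
  have : d / (2 * a) * entry_norm (val x) + d / (2 * a) < d.
    have -> : d / (2 * a) * entry_norm (val x) + d / (2 * a) = d / 2.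
      by rewrite /a; field; rewrite lt0r_neq0.
    by rewrite gtr_pMr // invf_lt1 // ltr1n.
  by lra.
have [C C0 hC] := RCP_product_bounded rcp.
pose Q : 'M[R]_n := 1%:M - projJ J.
have c0 : 0 < C * entry_norm Q + 1.
  by rewrite ltr_wpDl // mulr_ge0 ?entry_norm_ge0 // ltW.
have [m0 hm0] := hL (e / 2 / (C * entry_norm Q + 1)) ltac:(by rewrite !divr_gt0).
have [w /has_blocks_sub wJ] := ufar m0 0%N.
have := hm0 m0 (u m0) [::]; rewrite cats0 => /(_ erefl (us _)).
rewrite ltr_pdivlMr // => lt1; apply/negP; rewrite -leNgt.
have LQ : L *m word_prod w *m Q = 0.
  by rewrite (mul_word_prod_id LJ) // mulmxBr mulmx1 mul_projJ_id // subrr.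
rewrite -/Q -[_ *m Q]subr0 -LQ -!mulmxBl -mulmxA.
have : e / 2 <= ek m0 by rewrite lerDl divr_ge0 ?exprn_ge0 // ltW.
apply: le_trans; apply: le_trans (ltW lt1).
apply: le_trans (entry_normM _ _) _; rewrite ler_wpM2l ?entry_norm_ge0 //.
by rewrite (le_trans (entry_normM _ _)) // ler_wpDr // ler_wpM2r ?entry_norm_ge0.
Qed.

(** [W - P = W (1 - P)] for the product [W] of a word over [J], since its letters
fix the range of [P]. *)
Lemma word_prod_near_projJ J e : RCP Sg -> Defs.transversal Sg ->
  J != finset.set0 -> 0 < e ->
  exists m, forall w, has_blocks J m w ->
    entry_norm (word_prod w - projJ J) < e.
Proof.
move=> rcp tr J0 e0; apply: contrapT => /forallNP no.
apply: (not_far1 rcp tr J0 (e := e / 2)); first by rewrite divr_gt0.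
move=> m; apply: contrapT => no_w; apply: (no m) => w bw.
rewrite ltNge; apply/negP => le; apply: no_w; exists w => //.
rewrite mul1mx mulmxBr mulmx1 word_prod_projJ; last exact: has_blocks_sub bw.
by rewrite (lt_le_trans _ le) // gtr_pMr // invf_lt1 // ltr1n.
Qed.

End Projection.

(** * Limits of the finite products *)

Section NetLimit.
Context {R : realType} {n : nat} (Sg : {fset 'M[R]_n}).
Context {d : Order.disp_t} {T : orderType d} (A : T -> Sg).
Implicit Types (S U : set T) (M : 'M[R]_n) (J : {set Sg}) (l : seq T).

(** Finite subsets of [S] are represented by their increasing enumerations. *)
Definition net_limit S M : Prop := forall e, 0 < e ->
  exists2 f : seq T, (forall x, x \in f -> S x) &
    forall l, sorted <%O l -> {subset f <= l} -> (forall x, x \in l -> S x) ->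
      entry_norm (word_prod (map A l) - M) < e.

Lemma sorted_filter_cat l (p : pred T) : sorted <%O l ->
  (forall x y, x \in l -> y \in l -> (x < y)%O -> p y -> p x) ->
  l = [seq x <- l | p x] ++ [seq x <- l | ~~ p x].
Proof.
elim: l => // x l IH; rewrite [sorted _ _](path_sortedE lt_trans).
move=> /andP[xl sl] pl.
have /IH {}IH := sl; rewrite /=; case: ifPn => px /=.
  by rewrite -IH // => y z yl zl; apply: pl; rewrite inE (yl, zl) orbT.
have np y : y \in l -> ~~ p y.
  move=> yl; apply: contra px; apply: pl; rewrite ?inE ?yl ?orbT ?eqxx //.
  exact: (allP xl).
have /eqP -> : [seq x <- l | p x] == [::].
  rewrite -size_eq0 size_filter -leqn0 leqNgt -has_count -all_predC.
  exact/allP.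
by congr cons; rewrite /= -[LHS]filter_predT; apply: eq_in_filter => y /np.
Qed.

Lemma net_limit_unique_sorted l M : sorted <%O l ->
  net_limit [set x | x \in l] M -> M = word_prod (map A l).
Proof.
move=> sl h; apply/eqP; rewrite -subr_eq0 -oppr_eq0 opprB; apply/eqP.
by apply: entry_norm_eq0 => e /h[f fl]; apply.
Qed.

Lemma net_limit0 : net_limit set0 1%:M.
Proof.
move=> e e0; exists [::] => // -[|x l] _ _ h; last by case: (h x (mem_head _ _)).
by rewrite /= word_prod_nil subrr entry_norm0.
Qed.

Lemma net_limitU S1 S2 M1 M2 : (forall x y, S1 x -> S2 y -> (x < y)%O) ->
  net_limit S1 M1 -> net_limit S2 M2 -> net_limit (S1 `|` S2) (M1 *m M2).
Proof.
move=> lt12 h1 h2 e e0.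
pose a := entry_norm M1 + entry_norm M2 + 2.
have n1 := entry_norm_ge0 M1; have n2 := entry_norm_ge0 M2.
have a0 : 0 < a by rewrite /a; lra.
have c0 : 0 < Num.min 1 (e / a) by rewrite lt_min ltr01 divr_gt0.
have [f1 f1S hf1] := h1 _ c0; have [f2 f2S hf2] := h2 _ c0.
exists (f1 ++ f2) => [x|l sl fl lS].
  by rewrite mem_cat => /orP[/f1S|/f2S]; [left|right].
pose p x := `[< S1 x >].
have lE : l = [seq x <- l | p x] ++ [seq x <- l | ~~ p x].
  apply: sorted_filter_cat => // x y xl yl xy /asboolP Sy; apply/asboolP.
  have [//|/(lt12 _ _ Sy)] := lS _ xl; by rewrite ltNge (ltW xy).
have d1 :
    entry_norm (word_prod (map A [seq x <- l | p x]) - M1) < Num.min 1 (e / a).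
  apply: hf1 => [|x xf|x]; first by apply: sorted_filter => //; exact: lt_trans.
    rewrite mem_filter fl ?mem_cat ?xf // andbT; apply/asboolP; exact: f1S.
  by rewrite mem_filter => /andP[/asboolP].
have d2 : entry_norm (word_prod (map A [seq x <- l | ~~ p x]) - M2) <
    Num.min 1 (e / a).
  apply: hf2 => [|x xf|x]; first by apply: sorted_filter => //; exact: lt_trans.
    rewrite mem_filter fl ?mem_cat ?xf ?orbT // andbT; apply/asboolPn => S1x.
    by have := lt12 _ _ S1x (f2S _ xf); rewrite ltxx.
  by rewrite mem_filter => /andP[/asboolPn nS1 /lS[]].
rewrite lE map_cat word_prod_cat.
move: d1 d2; set W1 := word_prod _; set W2 := word_prod _.
rewrite !lt_min => /andP[d1 d1'] /andP[d2 d2'].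
have -> : W1 *m W2 - M1 *m M2 = (W1 - M1) *m W2 + M1 *m (W2 - M2).
  by rewrite mulmxBl mulmxBr addrA subrK.
apply: le_lt_trans (entry_normD _ _) _.
apply: (@le_lt_trans _ _ (entry_norm (W1 - M1) * (entry_norm M2 + 1)
    + entry_norm M1 * entry_norm (W2 - M2))).
  apply: lerD; apply: le_trans (entry_normM _ _) _ => //.
  rewrite ler_wpM2l ?entry_norm_ge0 //.
  by rewrite (le_trans (entry_norm_le_add W2 M2)) // lerD2l ltW.
have ea : (e / a) * a = e by rewrite divfK // lt0r_neq0.
have {}d1' : entry_norm (W1 - M1) * (entry_norm M2 + 1) <
    (e / a) * (entry_norm M2 + 1).
  by rewrite ltr_pM2r //; lra.
have {}d2' : entry_norm M1 * entry_norm (W2 - M2) <= entry_norm M1 * (e / a).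
  by rewrite ler_wpM2l // ltW.
have c0' : 0 < e / a by rewrite divr_gt0.
move: d1' d2' c0' ea; set q := e / a; rewrite /a => d1' d2' q0 ea.
have -> : e = q * (entry_norm M2 + 1) + entry_norm M1 * q + q.
  by rewrite -[LHS]ea; ring.
by rewrite ltr_wpDr ?ltr_leD // ltW.
Qed.

Lemma net_limit_prod m (U : 'I_m -> set T) (M : 'I_m -> 'M[R]_n) :
  (forall (i j : 'I_m) x y, (i < j)%N -> U i x -> U j y -> (x < y)%O) ->
  (forall i, net_limit (U i) (M i)) ->
  net_limit (\bigcup_i U i) (\prod_(i < m) M i).
Proof.
elim: m U M => [|m IH] U M ltU limU.
  rewrite big_ord0 (_ : \bigcup_i U i = set0); first exact: net_limit0.
  by apply/seteqP; split=> // x [[]].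
rewrite big_ord_recl.
rewrite (_ : \bigcup_i U i = U ord0 `|` \bigcup_i U (lift ord0 i)).
  apply: net_limitU => //; last first.
    by apply: IH => // i j x y ij; exact: ltU.
  by move=> x y U0 [j _ Uj]; exact: ltU U0 Uj.
apply/seteqP; split=> x; last first.
  by case=> [?|[j _ ?]]; [exists ord0|exists (lift ord0 j)].
case=> i _; case: (unliftP ord0 i) => [j|] -> Ux; last by left.
by right; exists j.
Qed.

Lemma net_limit_power S (X : Sg) m : (forall x, S x -> A x = X) ->
  (S #= `I_m)%card -> net_limit S (val X ^+ m).
Proof.
move=> SX cS.
have finS : finite_set S by exists m.
have /finite_seqP[s sS] := finS.
move=> e e0; exists s => [x xs|l sl fl lS]; first by rewrite sS.
have us : uniq l by apply: sorted_uniq sl; [exact: lt_trans|exact: ltxx].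
have Sl : S = [set` [fset x in l]%fset].
  by apply/seteqP; split=> x /=; rewrite inE; [rewrite {1}sS => /fl|exact: lS].
have sz : size l = m.
  by move: cS; rewrite Sl => /card_eq_fsetP <-; rewrite card_fseq undup_id.
have -> : map A l = nseq m X.
  rewrite -sz -(size_map A l); apply/all_pred1P/allP => _ /mapP[x xl ->].
  by apply/eqP/SX/lS.
have -> : word_prod (nseq m X) = val X ^+ m.
  elim: (m) => [|k IH]; first exact: word_prod_nil.
  by rewrite /= -cat1s word_prod_cat word_prod1 IH exprS.
by rewrite subrr entry_norm0.
Qed.

Definition covers J U : Prop := forall X, X \in J -> exists2 x, U x & A x = X.

(** The extreme one among chosen witnesses of the letters; it serves with both
[<=] and [>=]. *)
Lemma covers_extremum (r : rel T) J U : total r -> transitive r ->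
  J != finset.set0 -> covers J U ->
  exists2 y, U y & covers J (U `&` [set x | r x y]).
Proof.
move=> tr trr /set0Pn[X0 X0J] cU.
suff [y Uy hy] : exists2 y, U y & forall X, X \in enum J ->
    exists2 x, U x /\ r x y & A x = X.
  by exists y => // X; rewrite -mem_enum => /hy[x []]; exists x.
have : forall X, X \in enum J -> exists2 x, U x & A x = X.
  by move=> X; rewrite mem_enum => /cU.
elim: (enum J) => [_|X s IH hs].
  by have [y Uy _] := cU _ X0J; exists y.
have [y Uy hy] := IH (fun Y Ys => hs Y ltac:(by rewrite inE Ys orbT)).
have [x Ux Ax] := hs X (mem_head _ _).
have rxx z : r z z by have := tr z z; rewrite orbb.
have [xy|yx] := orP (tr x y).
  exists y => // Y; rewrite inE => /orP[/eqP ->|]; first by exists x.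
  exact: hy.
exists x => // Y; rewrite inE => /orP[/eqP ->|]; first by exists x.
by move=> /hy[z [Uz zy] Az]; exists z => //; split=> //; exact: trr yx.
Qed.

(** [m] disjoint covering intervals, listed from the left by cut points; unlike
a family indexed by [m], this can be processed by induction along a word. *)
Fixpoint cover_chain J m S : Prop :=
  if m is m'.+1 then
    exists2 y, covers J (S `&` [set x | (x <= y)%O]) &
      cover_chain J m' (S `&` [set x | (y < x)%O])
  else True.

(** Disjoint nonempty intervals are linearly ordered, so the one with the least
representative [x i0] lies to the left of all the others. *)
Lemma disjoint_cover_chain J m S (U : 'I_m -> set T) : J != finset.set0 ->
  (forall i, U i `<=` S) ->
  (forall i a b g, U i a -> U i b -> S g -> (a < g)%O -> (g < b)%O -> U i g) ->
  (forall i, covers J (U i)) -> (forall i j x, U i x -> U j x -> i = j) ->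
  cover_chain J m S.
Proof.
move=> J0; elim: m S U => // m IH S U US Uconv Ucov Udis.
have [X0 X0J] := set0Pn _ J0.
have xex i : exists x, U i x by have [x] := Ucov i _ X0J; exists x.
have [x xU] := choice xex.
pose i0 := [arg min_(i < ord0) x i]%O.
have x0min i : (x i0 <= x i)%O.
  by rewrite /i0; case: arg_minP => // j _; apply.
have [y Uy ycov] := covers_extremum le_total le_trans J0 (Ucov i0).
exists y.
  by move=> X /ycov[z [Uz zy] Az]; exists z => //; split=> //; exact: US Uz.
apply: (IH _ (fun i => U (lift i0 i)))
  => [i z Uz|i a b g Ua Ub [Sg0 _]|i|i j z Ui Uj].
- split; first exact: US Uz.
  have ne t : U i0 t -> U (lift i0 i) t -> False.
    move=> h1 h2; have /eqP := Udis _ _ _ h1 h2.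
    by rewrite (negPf (neq_lift _ _)).
  rewrite /= ltNge; apply/negP; rewrite le_eqVlt => /orP[/eqP zy|zy].
    by apply: (ne y) => //; rewrite -zy.
  have [|] := ltP (x i0) z => [xz|].
    by apply: (ne z) => //; apply: (Uconv i0) xz zy => //; exact: US Uz.
  rewrite le_eqVlt => /orP[/eqP zx|zx]; first by apply: (ne z); rewrite // zx.
  apply: (ne (x i0)) => //; apply: Uconv Uz (xU _) _ zx _; first exact: US (xU _).
  rewrite lt_neqAle x0min andbT; apply/eqP => xx.
  by apply: (ne (x i0)) => //; rewrite xx.
- exact: Uconv.
- exact: Ucov.
- exact: lift_inj (Udis _ _ _ Ui Uj).
Qed.

Lemma cover_chain_blocks J m S : (forall x, S x -> A x \in J) ->
  cover_chain J m S ->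
  exists2 f : seq T, (forall x, x \in f -> S x) &
    forall l, sorted <%O l -> {subset f <= l} -> (forall x, x \in l -> S x) ->
      has_blocks J m (map A l).
Proof.
elim: m S => [|m IH] S SJ /=.
  by move=> _; exists [::] => // l _ _ lS _ /mapP[x /lS/SJ ? ->].
case=> y cov /IH[x [] //|f fS hf]; first by move=> /SJ.
have wit X : exists x, X \in J -> [/\ S x, (x <= y)%O & A x = X].
  case: (boolP (X \in J)) => [/cov[x [? ?] ?]|]; first by exists x.
  by exists y.
have [g gP] := choice wit.
exists (map g (enum J) ++ f) => [x|l sl fl lS].
  rewrite mem_cat => /orP[/mapP[X]|/fS[]//].
  by rewrite mem_enum => /gP[? _ _ ->].
have lE : l = [seq x <- l | (x <= y)%O] ++ [seq x <- l | ~~ (x <= y)%O].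
  by apply: sorted_filter_cat => // x z _ _ xz; apply: le_trans (ltW xz).
exists (map A [seq x <- l | (x <= y)%O]).
exists (map A [seq x <- l | ~~ (x <= y)%O]).
split.
- by rewrite -map_cat -lE.
- move=> X; apply/mapP/idP => [[x] | XJ].
    by rewrite mem_filter => /andP[_ /lS/SJ ? ->].
  have [Sx xy Ax] := gP _ XJ; exists (g X) => //.
  by rewrite mem_filter xy fl // mem_cat map_f // mem_enum.
- apply: hf => [|x xf|x]; first by apply: sorted_filter => //; exact: lt_trans.
    have [_ yx] := fS _ xf.
    by rewrite mem_filter /= -ltNge yx fl // mem_cat xf orbT.
  by rewrite mem_filter /= -ltNge => /andP[? /lS].
Qed.

Lemma mem_JS S X : reflect (exists2 x, S x & A x = X) (X \in JS A S).
Proof. by rewrite inE; exact: asboolP. Qed.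

Lemma JS_neq0 S : S !=set0 -> JS A S != finset.set0.
Proof. by case=> x Sx; apply/set0Pn; exists (A x); apply/mem_JS; exists x. Qed.

Lemma net_limit_projJ S : RCP Sg -> Defs.transversal Sg ->
  S !=set0 -> infinite_IS A S -> net_limit S (projJ (JS A S)).
Proof.
move=> rcp tr S0 inf e e0.
have [m hm] := word_prod_near_projJ rcp tr (JS_neq0 S0) e0.
have [U [Uc Ut]] := inf m.
have ch : cover_chain (JS A S) m S.
  apply: (disjoint_cover_chain (JS_neq0 S0) (U := U)) => [i|i|i X|i j x Ui Uj].
  - by have [[]] := Uc i.
  - by have [[_ h] _] := Uc i.
  - by have [_ UA] := Uc i; move=> /mem_JS XS; have : (A @` U i) X by rewrite UA.
  - by apply: Ut => //; exists x.
have [|f fS hf] := cover_chain_blocks _ ch.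
  by move=> x Sx; apply/mem_JS; exists x.
by exists f => // l sl fl lS; apply: hm; exact: hf.
Qed.

Lemma is_product_net_limit S M : RCP Sg -> Defs.transversal Sg ->
  is_product A S M -> net_limit S M.
Proof.
move=> rcp tr; elim=> {S M} [|S|S m U M S0 _ _ [_ <- ltU] _ IH|S X m S0 _ SX cS].
- exact: net_limit0.
- exact: net_limit_projJ.
- exact: net_limit_prod.
- apply: net_limit_power => // x Sx; apply/set1P.
  by rewrite -SX; apply/mem_JS; exists x.
Qed.

End NetLimit.

(** * Existence of M(S) *)

Section Existence.
Context {R : realType} {n : nat} (Sg : {fset 'M[R]_n}).
Context {d : Order.disp_t} {T : orderType d} (A : T -> Sg).
Implicit Types (S U V : set T) (M : 'M[R]_n) (J : {set Sg}).

(** A partition into incomplete intervals, encoded by the nondecreasing function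
giving the number of the part: some parts may be empty, and such functions are
easily restricted and glued. *)
Definition finitely_split J m S : Prop := exists f : T -> nat,
  [/\ forall x, S x -> (f x < m)%N,
      forall x y, S x -> S y -> (x <= y)%O -> (f x <= f y)%N
    & forall i, ~ covers A J (S `&` [set x | f x = i])].

Definition splittable J S : Prop := exists m, finitely_split J m S.

Lemma covers_sub J U V : U `<=` V -> covers A J U -> covers A J V.
Proof. by move=> UV cU X /cU[x Ux Ax]; exists x => //; exact: UV. Qed.

Lemma splittable_sub J U V : U `<=` V -> splittable J V -> splittable J U.
Proof.
move=> UV [m [f [fm fmono fc]]]; exists m, f; split.
- by move=> x /UV/fm.
- by move=> x y /UV Vx /UV; exact: fmono.
- by move=> i cU; apply: (fc i); apply: covers_sub cU => x [/UV].
Qed.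

Lemma splittable_not_covers J U : ~ covers A J U -> splittable J U.
Proof.
move=> nc; exists 1%N, (fun=> 0%N); split=> // i cU.
by apply: nc; apply: covers_sub cU => x [].
Qed.

Lemma splittable1 J x : (1 < #|J|)%N -> splittable J [set x].
Proof.
move=> /card_gt1P[X [Y [XJ YJ XY]]]; apply: splittable_not_covers => c.
have [_ -> eX] := c _ XJ; have [_ -> eY] := c _ YJ.
by rewrite -eX -eY eqxx in XY.
Qed.

Lemma splittableU J U V : (forall x y, U x -> V y -> (x < y)%O) ->
  splittable J U -> splittable J V -> splittable J (U `|` V).
Proof.
move=> UV [m [f [fm fmono fc]]] [k [g [gk gmono gc]]].
pose h x := if `[< U x >] then f x else (m + g x)%N.
have hU x : U x -> h x = f x by move=> Ux; rewrite /h asboolT.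
have hV x : ~ U x -> h x = (m + g x)%N by move=> Ux; rewrite /h asboolF.
exists (m + k)%N, h; split.
- move=> x UVx; case: (pselect (U x)) => Ux; first by rewrite hU // ltn_addr // fm.
  by rewrite hV // ltn_add2l gk //; case: UVx.
- move=> x y UVx UVy xy; case: (pselect (U x)) => Ux; case: (pselect (U y)) => Uy.
  + by rewrite !hU // fmono.
  + by rewrite hU // hV // (leq_trans (ltnW (fm _ Ux))) // leq_addr.
  + by case: UVx => // Vx; have := UV _ _ Uy Vx; rewrite ltNge xy.
  + by rewrite !hV // leq_add2l; case: UVx UVy => // Vx [] // Vy; exact: gmono.
- move=> i c; case: (ltnP i m) => im.
    apply: (fc i); apply: covers_sub c => x [UVx /= hx].
    case: (pselect (U x)) => Ux; first by rewrite hU in hx.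
    by move: im; rewrite -hx hV // ltnNge leq_addr.
  apply: (gc (i - m)%N); apply: covers_sub c => x [UVx /= hx].
  case: (pselect (U x)) => Ux.
    by move: im; rewrite -hx hU // leqNgt fm.
  by split; [case: UVx|rewrite /= -hx hV // addKn].
Qed.

Definition convex_in S U : Prop :=
  forall a b g, U a -> U b -> S g -> (a < g)%O -> (g < b)%O -> U g.

(** Let [D] be the set of the points of [S] up to which [S] is splittable.  If
[D] is not splittable, neither is any of its final segments, since the initial
segments of [D] are; otherwise [S `\` D] is not splittable, and neither is any
of its nonempty initial segments, by definition of [D] and because single points
are splittable.  Unsplittable sets cover [J], so a covering interval can be cut
off at one end of [D] or [S `\` D], leaving an unsplittable rest. *)
Lemma not_splittable_peel J S : (1 < #|J|)%N -> ~ splittable J S ->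
  exists V U, [/\ V `<=` S /\ U `<=` S, convex_in S V /\ convex_in S U,
    forall x, V x -> ~ U x, covers A J V & ~ splittable J U].
Proof.
move=> J1 nS.
have J0 : J != finset.set0 by rewrite -card_gt0 (leq_trans _ J1).
have covJ U : ~ splittable J U -> covers A J U.
  by move=> nU; apply: contrapT => /splittable_not_covers.
pose upto y := S `&` [set x | (x <= y)%O].
pose D := [set x | S x /\ splittable J (upto x)].
have Ddown x y : D y -> S x -> (x <= y)%O -> D x.
  move=> [_ sy] Sx xy; split=> //; apply: splittable_sub sy => z [Sz zx].
  by split=> //; exact: le_trans xy.
have DS : D `<=` S by move=> x [].
case: (pselect (splittable J D)) => [sD|nD]; last first.
  have [y Dy cy] := covers_extremum le_total le_trans J0 (covJ _ nD).
  exists (D `&` [set x | (x <= y)%O]), (D `&` [set x | (y < x)%O]); split.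
  - by split=> x [/DS].
  - split=> a b g [Da ya] [Db yb] Sg0 ag gb; split.
    + by apply: Ddown Db _ _ => //; exact: ltW.
    + by apply: le_trans yb; exact: ltW.
    + by apply: Ddown Db _ _ => //; exact: ltW.
    + exact: lt_trans ag.
  - by move=> x [_ /= xy] [_ /=]; rewrite ltNge xy.
  - exact: cy.
  - move=> sU; apply: nD.
    have lt a b : upto y a -> (D `&` [set x | (y < x)%O]) b -> (a < b)%O.
      by move=> [_ ay] [_]; exact: le_lt_trans.
    apply: splittable_sub (splittableU lt Dy.2 sU) => x Dx.
    by case: (leP x y) => xy; [left; split=> //; exact: DS|right].
pose E := S `\` D.
have Eup x y : E x -> S y -> (x <= y)%O -> E y.
  move=> [Sx nDx] Sy xy; split=> // Dy; apply: nDx; exact: Ddown xy.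
have DE x y : D x -> E y -> (x < y)%O.
  move=> Dx [Sy nDy]; rewrite ltNge; apply/negP => yx; apply: nDy.
  exact: Ddown yx.
have nE : ~ splittable J E.
  move=> sE; apply: nS; have := splittableU DE sD sE.
  by apply: splittable_sub => x Sx; case: (pselect (D x)); [left|right].
have ge_trans' : transitive (>=%O : rel T).
  by move=> a b c ab ca; exact: le_trans ca ab.
have ge_total' : total (>=%O : rel T) by move=> a b; exact: le_total.
have [y Ey cy] := covers_extremum ge_total' ge_trans' J0 (covJ _ nE).
exists (E `&` [set x | (y <= x)%O]), (E `&` [set x | (x < y)%O]); split.
- by split=> x [[]].
- split=> a b g [Ea ya] [Eb yb] Sg0 ag gb; split.
  + by apply: Eup Ea _ _ => //; exact: ltW.
  + by apply: le_trans ya _; exact: ltW.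
  + by apply: Eup Ea _ _ => //; exact: ltW.
  + exact: lt_trans yb.
- by move=> x [_ /= xy] [_ /=]; rewrite ltNge xy.
- exact: cy.
- move=> sU; apply: Ey.2; split; first exact: Ey.1.
  have lt1 a b : (E `&` [set x | (x < y)%O]) a -> [set y] b -> (a < b)%O.
    by move=> [_ ay] ->.
  have lt2 a b : D a -> (E `&` [set x | (x < y)%O] `|` [set y]) b -> (a < b)%O.
    by move=> Da [[Eb _]|->]; exact: DE.
  have := splittableU lt2 sD (splittableU lt1 sU (splittable1 y J1)).
  apply: splittable_sub => x [Sx /=]; rewrite le_eqVlt => /orP[/eqP ->|xy].
    by right; right.
  by case: (pselect (D x)) => Dx; [left|right; left].
Qed.

Lemma not_splittable_disjoint J S m : (1 < #|J|)%N -> ~ splittable J S ->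
  exists U : 'I_m -> set T,
    [/\ forall i, U i `<=` S, forall i, convex_in S (U i),
        forall i, covers A J (U i) & forall i j x, U i x -> U j x -> i = j].
Proof.
move=> J1; elim: m S => [|m IH] S nS.
  by exists (fun=> set0); split=> -[].
have [V [S' [[VS S'S] [cV cS'] VS' covV nS']]] := not_splittable_peel J1 nS.
have [U [US Uc Ucov Udis]] := IH _ nS'.
exists (fun i => if unlift ord0 i is Some j then U j else V); split.
- by move=> i; case: (unlift ord0 i) => // j; exact: subset_trans S'S.
- move=> i; case: (unlift ord0 i) => [j|]; last exact: cV.
  move=> a b g Ua Ub Sg0 ag gb.
  apply: (Uc j _ _ _ Ua Ub _ ag gb).
  by apply: (cS' _ _ _ (US _ _ Ua) (US _ _ Ub)).
- by move=> i; case: (unlift ord0 i).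
- move=> i j x.
  case: (unliftP ord0 i) => [i'|] ->; case: (unliftP ord0 j) => [j'|] -> //.
  + by move=> /Udis h /h ->.
  + by move=> /US S'x /VS'.
  + by move=> /VS' + /US.
Qed.

(** In a splitting with the least number of parts no part is empty, as an empty
part could be dropped by renumbering. *)
Lemma finitely_split_nonempty J S : splittable J S -> exists m f,
  [/\ forall x, S x -> (f x < m)%N,
      forall x y, S x -> S y -> (x <= y)%O -> (f x <= f y)%N,
      forall i, ~ covers A J (S `&` [set x | f x = i])
    & forall i, (i < m)%N -> exists2 x, S x & f x = i].
Proof.
move=> [m0 hm0].
have exm : exists m, `[< finitely_split J m S >] by exists m0; apply/asboolP.
case: (ex_minnP exm) => m /asboolP[f [fm fmono fc]] mmin.
exists m, f; split=> // i im; apply: contrapT => no.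
have fi x : S x -> f x <> i by move=> Sx fx; apply: no; exists x.
suff /mmin : `[< finitely_split J m.-1 S >] by lia.
apply/asboolP; exists (fun x => if (f x < i)%N then f x else (f x).-1); split.
- by move=> x Sx; have := fm _ Sx; have := fi _ Sx; case: ifP; lia.
- move=> x y Sx Sy xy; have := fmono _ _ Sx Sy xy.
  by have := fi _ Sx; have := fi _ Sy; do 2!case: ifP; lia.
- move=> j c; case: (ltnP j i) => ji; [apply: (fc j)|apply: (fc j.+1)];
    apply: covers_sub c => x [Sx /= fx]; split=> //=;
    by have := fi _ Sx; move: fx ji; case: ifP; lia.
Qed.

Lemma infinite_IS_singleton S X : infinite_set S ->
  (forall x, S x -> A x = X) -> infinite_IS A S.
Proof.
move=> infS SX m; have [B BS mB] := infinite_set_fset m infS.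
have [x0 _] : S !=set0 by apply: infinite_setN0.
pose t (i : 'I_m) := nth x0 (enum_fset B) i.
have tB (i : 'I_m) : (i < size (enum_fset B))%N by apply: leq_trans mB.
have tS i : S (t i) by apply: BS; exact: mem_nth.
exists (fun i => [set t i]); split.
- move=> i; split; first split.
  + by move=> _ ->.
  + by move=> a b g -> -> _ tg gt; have := lt_trans tg gt; rewrite ltxx.
  + apply/seteqP; split=> Y [x] => [->|Sx] <-; first by exists (t i).
    by exists (t i) => //; rewrite !SX.
- move=> i j _ _ [x [-> /eqP]]; rewrite nth_uniq ?fset_uniq //.
  by move=> /eqP/val_inj.
Qed.

(** Induction on the number of letters: the parts of an incomplete partition use
fewer letters than [S]. *)
Lemma is_product_exists S : exists M, is_product A S M.
Proof.
have [k] := ubnP #|JS A S|; elim: k S => // k IH S; rewrite ltnS => Sk.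
have [->|S0] := eqVneq S set0; first by exists 1%:M; exact: is_product_empty.
have {}S0 : S !=set0 by apply/set0P.
case: (pselect (infinite_IS A S)) => [inf|ninf].
  by exists (projJ (JS A S)); exact: is_product_infinite.
have J0 : (0 < #|JS A S|)%N by rewrite card_gt0 JS_neq0.
case: (leqP 2 #|JS A S|) => J1; last first.
  have /cards1P[X SX] : #|JS A S| == 1%N by rewrite eqn_leq -ltnS J1.
  have AX x : S x -> A x = X.
    by move=> Sx; apply/set1P; rewrite -SX; apply/mem_JS; exists x.
  have [m cS] : finite_set S.
    by apply: contrapT => infS; apply: ninf; exact: infinite_IS_singleton AX.
  by exists (val X ^+ m); exact: is_product_power.
have /finitely_split_nonempty[m [f [fm fmono fc fne]]] : splittable (JS A S) S.
  apply: contrapT => nS; apply: ninf => m.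
  have [U [US Uc Ucov Udis]] := not_splittable_disjoint m J1 nS.
  exists U; split; last by move=> i j _ _ [x [Ui Uj]]; exact: Udis Ui Uj.
  move=> i; split; first by split; [exact: US|exact: Uc].
  apply/seteqP; split=> X; first by case=> x /US Sx <-; exists x.
  by move=> /mem_JS/(Ucov i).
pose U (i : 'I_m) := S `&` [set x | f x = i].
have US i : U i `<=` S by move=> x [].
have prodU i : exists M, is_product A (U i) M.
  apply: IH; apply: leq_trans Sk; apply: proper_card; apply/properP; split.
    by apply/fintype.subsetP => X /mem_JS[x /US Sx <-]; apply/mem_JS; exists x.
  apply: contrapT => no; apply: (fc i) => X XJ; apply/mem_JS.
  by apply: contrapT => /negP XU; apply: no; exists X.
have [M MU] := choice prodU.
exists (\prod_(i < m) M i); apply: is_product_split (MU) => //.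
split.
- move=> i; split; first by have [x Sx fx] := fne i (ltn_ord i); exists x.
  split; first split=> // a b g [Sa fa] [Sb fb] Sg0 ag gb.
    split=> //=; apply/eqP; rewrite eqn_leq; apply/andP.
    by split; [rewrite -fb|rewrite -fa]; apply: fmono => //; exact: ltW.
  move=> UA; apply: (fc i) => X /mem_JS[x Sx Ax].
  by have : (A @` U i) X; [rewrite UA; exists x|].
- apply/seteqP; split=> x; first by case=> i _ /US.
  by move=> Sx; exists (Ordinal (fm _ Sx)).
- move=> i j x y ij [Sx fx] [Sy fy]; rewrite ltNge; apply/negP => yx.
  by move: (fmono _ _ Sy Sx yx); rewrite fx fy leqNgt ij.
Qed.

End Existence.

Lemma Mprod_net_limit (R : realType) (n : nat) (Sg : {fset 'M[R]_n})
    (d : Order.disp_t) (T : orderType d) (A : T -> Sg) (S : set T) :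
  RCP Sg -> Defs.transversal Sg -> net_limit A S (Mprod A S).
Proof.
move=> rcp tr; apply: is_product_net_limit => //.
have [M AM] := is_product_exists A S; exact: (xgetI _ AM).
Qed.

Theorem theorem4p6 (R : realType) (n : nat) (Sg : {fset 'M[R]_n})
    (d : Order.disp_t) (T : orderType d) (A : T -> Sg)
    (N : 'M[R]_n -> R) (hN : matrix_norm N) (hSg : CP Sg) :
  forall eps : R, 0 < eps ->
    exists F : set T, finite_set F /\
      forall F' : set T, finite_set F' -> F `<=` F' ->
        N (Mprod A F' - Mprod A setT) < eps.
Proof.
move=> eps eps0; have [_ rcp tr] := hSg.
have [c c0 Nc] := matrix_norm_le_entry_norm hN.
have [f _ hf] := Mprod_net_limit A setT rcp tr (divr_gt0 eps0 c0).
exists [set` f]; split; first exact: finite_seq.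
move=> F' finF' fF'.
pose l := sort <=%O (enum_fset (fset_set F')).
have lF' : F' = [set x | x \in l].
  by apply/seteqP; split=> x /=; rewrite mem_sort in_fset_set // inE.
have sl : sorted <%O l by rewrite sort_lt_sorted fset_uniq.
have -> : Mprod A F' = word_prod (map A l).
  apply: net_limit_unique_sorted => //; rewrite -lF'.
  exact: Mprod_net_limit.
apply: le_lt_trans (Nc _) _; rewrite mulrC -ltr_pdivlMr //.
by apply: hf => // x xf; have := fF' _ xf; rewrite {1}lF'.
Qed.
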